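(* Let $r_1,r_2$ be positive integers. For every $k\in\mathbb{Z}$, the element $y_k\in Frac(\mathcal{F}_2)$ belongs to $\mathcal{A}=\mathcal{A}(r_1,r_2)$; in particular, $y_k$ is a noncommutative Laurent polynomial in $y_1,y_2$ (i.e. $y_k\in\mathcal{F}_2$).
   Context: Let $\mathcal{F}_2=\mathbb{Q}\langle y_1^{\pm1},y_2^{\pm1}\rangle$ be the group algebra over $\mathbb{Q}$ of the free group on two generators $y_1,y_2$; its elements are called noncommutative Laurent polynomials in $y_1,y_2$. By Malcev, $\mathcal{F}_2$ embeds in a division ring; $Frac(\mathcal{F}_2)$ denotes the smallest one, i.e. the division subring generated by $\mathcal{F}_2$. Put $z=[y_2^{-1},y_1]=y_2^{-1}y_1y_2y_1^{-1}\in\mathcal{F}_2$. For $k\in\mathbb{Z}$ set $r_k=r_1$ if $k$ is odd and $r_k=r_2$ if $k$ is even. The elements $y_k\in Frac(\mathcal{F}_2)$ for $k\in\mathbb{Z}\setminus\{1,2\}$ are defined recursively (in both directions, starting from $y_1,y_2$) by $y_{k+1}\,z\,y_{k-1}=1+y_k^{r_k}$ for all $k\in\mathbb{Z}$. One has $y_0,y_3\in\mathcal{F}_2$, and $\mathcal{A}=\mathcal{A}(r_1,r_2)$ is the $\mathbb{Q}$-subalgebra of $\mathcal{F}_2$ generated by $y_0,y_1,y_2,y_3,z,z^{-1}$. *)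

(* Defs.v *)
From HB Require Import structures.
From mathcomp Require Import all_boot all_order all_algebra.
From mathcomp Require Import finmap.
From mathcomp.multinomials Require Import monalg.

Set Implicit Arguments.
Unset Strict Implicit.
Unset Printing Implicit Defensive.

Import GRing.Theory.

(* Free group on a type of generators X, as the set of reduced words: the
   letter (x, false) stands for x and (x, true) for x^-1. *)
Section FreeGroup.
Variable X : choiceType.

Definition letter : Type := X * bool.
Definition flip (l : letter) : letter := (l.1, ~~ l.2).

Definition no_cancel (l m : letter) : bool := m != flip l.
Definition reduced (w : seq letter) : bool := sorted no_cancel w.

Record free_group := FreeGroup { fg_word :> seq letter; _ : reduced fg_word }.
HB.instance Definition _ := [isSub for fg_word].
HB.instance Definition _ := [Choice of free_group by <:].

Definition push (l : letter) (w : seq letter) : seq letter :=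
  if w is m :: w' then if m == flip l then w' else l :: w else [:: l].
Definition act (u w : seq letter) : seq letter := foldr push w u.
Definition winv (w : seq letter) : seq letter := rev (map flip w).

Lemma flipK : involutive flip.
Proof. by case=> x b; rewrite /flip /= negbK. Qed.

Lemma reduced_behead l w : reduced (l :: w) -> reduced w.
Proof. exact: path_sorted. Qed.

Lemma push_reduced l w : reduced w -> reduced (push l w).
Proof.
case: w => [|m w] //= rw; case: eqP => [_|/eqP ne]; first exact: path_sorted rw.
by rewrite /reduced /= /no_cancel ne.
Qed.

Lemma act_reduced u w : reduced w -> reduced (act u w).
Proof. by move=> rw; elim: u => //= l u; apply: push_reduced. Qed.

Lemma pushK l w : reduced w -> push l (push (flip l) w) = w.
Proof.
case: w => [|m w] /=; first by rewrite eqxx.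
rewrite flipK; case: eqP => [->|_] rw; last by rewrite /= eqxx.
case: w rw => [|k w] //= /andP[ne _].
by rewrite (negbTE ne).
Qed.

Lemma act_push l v w : reduced w -> act (push l v) w = push l (act v w).
Proof.
case: v => [|m v] rw //=; case: eqP => [->|_] //=.
by rewrite pushK // act_reduced.
Qed.

Lemma actA u v w : reduced w -> act u (act v w) = act (act u v) w.
Proof. by move=> rw; elim: u => //= l u ->; rewrite act_push. Qed.

Lemma actw0 u : reduced u -> act u [::] = u.
Proof.
elim: u => //= l u IHu rlu; rewrite IHu; last exact: reduced_behead rlu.
by case: u {IHu} rlu => [|m u] //= /andP[/negbTE-> _].
Qed.

Lemma winvK : involutive winv.
Proof.
by move=> w; rewrite /winv map_rev revK -map_comp map_id_in // => l _ /=; exact: flipK.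
Qed.

Lemma winv_reduced w : reduced w -> reduced (winv w).
Proof.
rewrite /reduced /winv (rev_sorted no_cancel) sorted_map.
apply: sub_sorted => l m; rewrite /relpre /no_cancel; apply: contra => /eqP->.
by rewrite flipK.
Qed.

Lemma actVw u : reduced u -> act (winv u) u = [::].
Proof.
elim: u => //= l u IHu rlu; rewrite /winv /= rev_cons /act -cats1 foldr_cat /=.
by rewrite flipK eqxx; apply: IHu; exact: reduced_behead rlu.
Qed.

Definition fg_one := @FreeGroup [::] isT.
Definition fg_mul (u v : free_group) :=
  FreeGroup (act_reduced u (valP v)).
Definition fg_inv (u : free_group) := FreeGroup (winv_reduced (valP u)).

Lemma fg_mulA : associative fg_mul.
Proof. by move=> u v w; apply/val_inj/actA/valP. Qed.
Lemma fg_mul1 : left_id fg_one fg_mul.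
Proof. by move=> u; apply/val_inj. Qed.
Lemma fg_mulr1 : right_id fg_one fg_mul.
Proof. by move=> u; apply/val_inj/actw0/valP. Qed.
Lemma fg_mulV : left_inverse fg_one fg_inv fg_mul.
Proof. by move=> u; apply/val_inj/actVw/valP. Qed.
Lemma fg_mulrV : right_inverse fg_one fg_inv fg_mul.
Proof.
move=> u; apply/val_inj => /=.
by rewrite -{1}[fg_word u]winvK; apply/actVw/winv_reduced/valP.
Qed.

HB.instance Definition _ :=
  isGroup.Build free_group fg_mulA fg_mul1 fg_mulr1 fg_mulV fg_mulrV.

Definition fg_gen (x : X) : free_group := @FreeGroup [:: (x, false)] isT.
End FreeGroup.

(* Group algebra R[G]: finitely supported functions G -> R with the convolution
   product.  The product that monalg puts on {malg R[K]} is only available for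
   monoids without nontrivial units, so it is redone here on an alias. *)
Section GroupAlgebra.
Local Open Scope fset_scope.
Local Open Scope ring_scope.
Variables (R : comNzRingType) (G : groupType).

Definition group_algebra : Type := {malg R[G]}.
HB.instance Definition _ := GRing.Lmodule.on group_algebra.

Implicit Types g : {malg R[G]}.

Definition ga_one : {malg R[G]} := mkmalgU (1%g : G) 1.
Definition ga_mul g1 g2 : {malg R[G]} :=
  \sum_(k1 <- msupp g1) \sum_(k2 <- msupp g2)
    mkmalgU (k1 * k2)%g (mcoeff k1 g1 * mcoeff k2 g2).

Lemma ga_mulw (d1 d2 : {fset G}) g1 g2 :
  msupp g1 `<=` d1 -> msupp g2 `<=` d2 ->
  ga_mul g1 g2 = \sum_(k1 <- d1) \sum_(k2 <- d2)
    mkmalgU (k1 * k2)%g (mcoeff k1 g1 * mcoeff k2 g2).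
Proof.
move=> le_d1 le_d2; rewrite /ga_mul (big_fset_incl _ le_d1) /=.
  apply/eq_bigr=> k1 _; apply/big_fset_incl => // k _ /mcoeff_outdom ->.
  by rewrite mulr0 monalgU0.
move=> k _ /mcoeff_outdom g1k.
by rewrite big1 => // k' _; rewrite g1k mul0r monalgU0.
Qed.

Lemma ga_mulDl : left_distributive ga_mul +%R.
Proof.
move=> g1 g2 g.
rewrite (ga_mulw (msuppD_le g1 g2) (fsubset_refl _)).
rewrite (ga_mulw (fsubsetUl (msupp g1) (msupp g2)) (fsubset_refl _)).
rewrite (ga_mulw (fsubsetUr (msupp g1) (msupp g2)) (fsubset_refl _)).
rewrite -big_split /=; apply/eq_bigr=> k1 _.
rewrite -big_split /=; apply/eq_bigr=> k2 _.
by rewrite mcoeffD mulrDl monalgUD.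
Qed.

Lemma ga_mulDr : right_distributive ga_mul +%R.
Proof.
move=> g g1 g2.
rewrite (ga_mulw (fsubset_refl _) (msuppD_le g1 g2)).
rewrite (ga_mulw (fsubset_refl _) (fsubsetUl (msupp g1) (msupp g2))).
rewrite (ga_mulw (fsubset_refl _) (fsubsetUr (msupp g1) (msupp g2))).
rewrite -big_split /=; apply/eq_bigr=> k1 _.
rewrite -big_split /=; apply/eq_bigr=> k2 _.
by rewrite mcoeffD mulrDr monalgUD.
Qed.

Lemma ga_mul0g : left_zero 0 ga_mul.
Proof. by move=> g; rewrite /ga_mul msupp0 big_seq_fset0. Qed.

Lemma ga_mulg0 : right_zero 0 ga_mul.
Proof.
by move=> g; rewrite /ga_mul big1 // => k _; rewrite msupp0 big_seq_fset0.
Qed.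

Lemma ga_mulUU c1 c2 (k1 k2 : G) :
  ga_mul (mkmalgU k1 c1) (mkmalgU k2 c2) = mkmalgU (k1 * k2)%g (c1 * c2).
Proof. by rewrite (ga_mulw msuppU_le msuppU_le) !big_seq_fset1 !mcoeffUU. Qed.

Lemma ga_mulUg c (k : G) g :
  ga_mul (mkmalgU k c) g =
  \sum_(k' <- msupp g) mkmalgU (k * k')%g (c * mcoeff k' g).
Proof.
rewrite (ga_mulw msuppU_le (fsubset_refl _)) big_seq_fset1.
by apply/eq_bigr => k' _; rewrite mcoeffUU.
Qed.

Lemma ga_mulgU c (k : G) g :
  ga_mul g (mkmalgU k c) =
  \sum_(k' <- msupp g) mkmalgU (k' * k)%g (mcoeff k' g * c).
Proof.
rewrite (ga_mulw (fsubset_refl _) msuppU_le).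
by apply/eq_bigr=> k' _; rewrite big_seq_fset1 mcoeffUU.
Qed.

Lemma ga_mulEl g1 g2 :
  ga_mul g1 g2 = \sum_(k <- msupp g1) ga_mul (mkmalgU k (mcoeff k g1)) g2.
Proof. by apply/eq_bigr=> k _; rewrite ga_mulUg. Qed.

Lemma ga_mulEr g1 g2 :
  ga_mul g1 g2 = \sum_(k <- msupp g2) ga_mul g1 (mkmalgU k (mcoeff k g2)).
Proof.
by rewrite [LHS]exchange_big; apply/eq_bigr=> k _; rewrite ga_mulgU.
Qed.

Lemma ga_mul1g : left_id ga_one ga_mul.
Proof.
move=> g; rewrite ga_mulUg [RHS]monalgE.
by apply/eq_bigr=> k _; rewrite mul1r mul1g.
Qed.

Lemma ga_mulg1 : right_id ga_one ga_mul.
Proof.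
move=> g; rewrite ga_mulgU [RHS]monalgE.
by apply/eq_bigr=> k _; rewrite mulr1 mulg1.
Qed.

Lemma ga_mulA : associative ga_mul.
Proof.
move=> g1 g2 g3.
rewrite [RHS](big_morph (ga_mul^~ _) (fun _ _ => ga_mulDl _ _ _) (ga_mul0g _)).
rewrite ga_mulEl; apply/eq_bigr=> k1 _.
rewrite [LHS](big_morph (ga_mul _) (fun _ _ => ga_mulDr _ _ _) (ga_mulg0 _)).
rewrite [RHS](big_morph (ga_mul^~ _) (fun _ _ => ga_mulDl _ _ _) (ga_mul0g _)).
apply/eq_bigr=> k2 _.
rewrite [LHS](big_morph (ga_mul _) (fun _ _ => ga_mulDr _ _ _) (ga_mulg0 _)).
by rewrite ga_mulEr; apply/eq_bigr=> k3 _; rewrite !ga_mulUU mulrA mulgA.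
Qed.

Lemma ga_one_neq0 : ga_one != 0.
Proof. by rewrite monalgU_eq0 oner_neq0. Qed.

HB.instance Definition _ := GRing.Zmodule_isNzRing.Build group_algebra
  ga_mulA ga_mul1g ga_mulg1 ga_mulDl ga_mulDr ga_one_neq0.

Lemma ga_scaleE (c : R) g : c *: g = ga_mul (mkmalgU 1%g c) g.
Proof.
rewrite ga_mulUg; apply: eq_bigr => k _.
by rewrite mul1g.
Qed.

Lemma ga_scaleAl (c : R) (u v : group_algebra) : c *: (u * v) = (c *: u) * v.
Proof.
change (c *: ga_mul u v = ga_mul (c *: (u : {malg R[G]})) v).
by rewrite !ga_scaleE ga_mulA.
Qed.

HB.instance Definition _ :=
  GRing.Lmodule_isLalgebra.Build R group_algebra ga_scaleAl.

Lemma ga_scaleAr (c : R) (u v : group_algebra) : c *: (u * v) = u * (c *: v).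
Proof.
change (c *: ga_mul u v = ga_mul u (c *: (v : {malg R[G]}))).
rewrite !ga_scaleE !ga_mulA; congr ga_mul; rewrite ga_mulUg ga_mulgU.
by apply: eq_bigr => k _; rewrite mul1g mulg1 mulrC.
Qed.

HB.instance Definition _ :=
  GRing.Lalgebra_isAlgebra.Build R group_algebra ga_scaleAr.

End GroupAlgebra.

(* Locked so that unification does not start computing in R[G]. *)
HB.lock Definition ga_elt (R : comNzRingType) (G : groupType) (k : G)
  : group_algebra R G := mkmalgU k 1.
Canonical ga_elt_unlockable := Unlockable ga_elt.unlock.
Arguments ga_elt {R G} k%_g.

Lemma ga_eltM (R : comNzRingType) (G : groupType) (k1 k2 : G) :
  (ga_elt (k1 * k2) = ga_elt k1 * ga_elt k2 :> group_algebra R G)%R.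
Proof. by rewrite !unlock -[RHS]/(ga_mul _ _) ga_mulUU mulr1. Qed.

Lemma ga_elt1 (R : comNzRingType) (G : groupType) :
  (ga_elt 1 = 1 :> group_algebra R G)%R.
Proof. by rewrite unlock. Qed.

Local Open Scope ring_scope.

Inductive gen_subalg (R : pzRingType) (A : lalgType R) (S : A -> Prop)
  : A -> Prop :=
| gen_subalg_gen u of S u : gen_subalg S u
| gen_subalg_1 : gen_subalg S 1
| gen_subalg_lin a u v of gen_subalg S u & gen_subalg S v :
    gen_subalg S (a *: u + v)
| gen_subalg_mul u v of gen_subalg S u & gen_subalg S v :
    gen_subalg S (u * v).

Definition division_ring (D : unitRingType) : Prop :=
  forall x : D, x != 0 -> x \is a GRing.unit.

Inductive gen_divring (D : unitRingType) (S : D -> Prop) : D -> Prop :=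
| gen_divring_gen u of S u : gen_divring S u
| gen_divring_1 : gen_divring S 1
| gen_divring_sub u v of gen_divring S u & gen_divring S v :
    gen_divring S (u - v)
| gen_divring_mul u v of gen_divring S u & gen_divring S v :
    gen_divring S (u * v)
| gen_divring_inv u of gen_divring S u & u != 0 : gen_divring S u^-1.

Notation free_group2 := (free_group 'I_2).
Notation F2 := (group_algebra rat free_group2).

Definition gy1 : free_group2 := fg_gen ord0.
Definition gy2 : free_group2 := fg_gen ord_max.
(* Not mathcomp's commutator [~ x, y] = x^-1 * y^-1 * x * y. *)
Definition gz : free_group2 := (gy2^-1 * gy1 * gy2 * gy1^-1)%g.

Definition ly1 : F2 := ga_elt gy1.
Definition ly2 : F2 := ga_elt gy2.
Definition lz : F2 := ga_elt gz.

(* The solutions in F2 of y_2 z y_0 = 1 + y_1^r1 and y_3 z y_1 = 1 + y_2^r2. *)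
Definition ly0 (r1 : nat) : F2 := ga_elt (gz^-1 * gy2^-1) * (1 + ly1 ^+ r1).
Definition ly3 (r2 : nat) : F2 := (1 + ly2 ^+ r2) * ga_elt (gy1^-1 * gz^-1).

Definition in_calA (r1 r2 : nat) : F2 -> Prop :=
  gen_subalg (fun u => [\/ u = ly0 r1, u = ly1, u = ly2 | u = ly3 r2]
                       \/ u = lz \/ u = ga_elt gz^-1).

(* Frac(F2), relative to an embedding iota of F2 in a division ring. *)
Definition in_Frac (D : unitRingType) (iota : F2 -> D) : D -> Prop :=
  gen_divring (fun d => exists u : F2, d = iota u).

Definition r_parity (r1 r2 : nat) (k : int) : nat := if odd `|k|%N then r1 else r2.

Definition cluster_seq (r1 r2 : nat) (D : unitRingType) (iota : F2 -> D)
    (y : int -> D) : Prop :=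
  [/\ forall k, in_Frac iota (y k), y 1 = iota ly1, y 2 = iota ly2 &
      forall k : int,
        y (k + 1) * iota lz * y (k - 1) = 1 + y k ^+ r_parity r1 r2 k].

(* Main.v *)
(* Consecutive cluster variables satisfy y_k y_(k+1) = y_(k+1) z y_k, which
   turns y_(k+1) z y_(k-1) = 1 + y_k^r into z y_(k-1) y_(k+1) = 1 + (z y_k)^r.
   Multiplying the latter for k = 1 by y_3^r on the left gives
     y_3^r z y_0 y_2 = y_3^r + y_3^r (z y_1)^r,
   and y_3^r (z y_1)^r telescopes to 1 modulo a left multiple of y_2, because
   y_3 z y_1 = 1 + y_2^s and y_2 (z y_1) = y_1 y_2.  Hence
   y_4 z y_2 = 1 + y_3^r is an explicit element of A times y_2, so y_4 lies in A;
   shifting the index gives all k >= 4, and reversing products gives k < 0.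
   The recursion never divides by zero: the augmentation sending the free group
   to 1 maps each y_k to a positive rational. *)
Require Import Defs.
From HB Require Import structures.
From mathcomp Require Import all_boot all_order all_algebra.
From mathcomp Require Import finmap.
From mathcomp.multinomials Require Import monalg.

Set Implicit Arguments.
Unset Strict Implicit.
Unset Printing Implicit Defensive.

Import Order.TTheory GRing.Theory Num.Theory.

Local Open Scope ring_scope.

(** * Exchange relations in an arbitrary ring *)

Lemma commuteX2 (R : pzRingType) (u v w : R) n :
  u * v = w * u -> u * v ^+ n = w ^+ n * u.
Proof.
move=> uv; elim: n => [|n IHn]; rewrite ?mulr1 ?mul1r //.
by rewrite !exprS mulrA uv -mulrA IHn mulrA.
Qed.

(** Left multiplication by the unit [c * z] turns both sides into [b * (1 + b ^+ r)], since
    [c * z * b = b * c]. *)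
Lemma exchange_prev (R : unitRingType) (a b c z : R) r :
    c \is a GRing.unit -> z \is a GRing.unit ->
    b * c = c * z * b -> c * z * a = 1 + b ^+ r ->
  a * b = b * z * a.
Proof.
move=> Uc Uz bc cza; have Ucz : c * z \is a GRing.unit by rewrite unitrMr.
apply: (mulrI Ucz); rewrite mulrA cza !mulrA -bc -!mulrA (mulrA c) cza.
by rewrite mulrDl mulrDr mul1r mulr1 (commuteX2 _ (erefl (b * b))).
Qed.

(** Conjugation by the unit [z * a] takes [b] to [z * b] and [c * z * a] to [z * a * c]. *)
Lemma exchange_twisted (R : unitRingType) (a b c z : R) r :
    a \is a GRing.unit -> z \is a GRing.unit ->
    a * b = b * z * a -> c * z * a = 1 + b ^+ r ->
  z * a * c = 1 + (z * b) ^+ r.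
Proof.
move=> Ua Uz ab cza; have Uza : z * a \is a GRing.unit by rewrite unitrMr.
apply: (mulIr Uza); rewrite -!mulrA (mulrA c) cza mulrA mulrDr mulrDl mulr1 mul1r.
by rewrite (@commuteX2 _ (z * a) b (z * b)) // -!mulrA ab !mulrA.
Qed.

(** The innermost factor [d * (z * b)] is replaced by [1 + c ^+ s.+1]; one [c] then moves to the far
    right, turning each [z * b] it passes into [b]. *)
Lemma telescope_exchange (R : pzRingType) (b c d z : R) r s :
    b * c = c * z * b -> d * z * b = 1 + c ^+ s.+1 ->
  d ^+ r * (z * b) ^+ r
    = 1 + (\sum_(j < r) d ^+ j * c ^+ s * b ^+ j) * c.
Proof.
move=> bc dzb; elim: r => [|r IHr]; first by rewrite big_ord0 mul0r addr0 mulr1.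
rewrite exprSr exprS -mulrA (mulrA d) (mulrA d) dzb mulrDl mul1r mulrDr IHr.
rewrite big_ord_recr /= mulrDl addrA; congr (_ + _).
rewrite exprSr -!mulrA; congr (_ * (_ * _)).
by apply: commuteX2; rewrite mulrA -bc.
Qed.

(* For z = 1 and commuting variables this is
   y_4 = y_3^r y_0 - ((1 + y_2^s)^r - 1) / y_2. *)
Lemma exchange_next (R : unitRingType) (a b c d z : R) r s :
    a \is a GRing.unit -> c \is a GRing.unit -> z \is a GRing.unit ->
    b * c = c * z * b -> c * z * a = 1 + b ^+ r -> d * z * b = 1 + c ^+ s.+1 ->
  (d ^+ r * z * a - \sum_(j < r) d ^+ j * c ^+ s * b ^+ j) * c = 1 + d ^+ r.
Proof.
move=> Ua Uc Uz bc cza dzb; have ab := exchange_prev Uc Uz bc cza.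
have zac := exchange_twisted Ua Uz ab cza.
rewrite mulrBl -!mulrA (mulrA z) zac mulrDr mulr1 (telescope_exchange r bc dzb).
by rewrite addrA addrK addrC.
Qed.

(** * Mirror images, obtained in the opposite ring *)

Section Converse.
Variable R : unitRingType.
Implicit Types a b c d z : R.

(** In [R^c] the relations keep their shape once [b] is exchanged with [c] and [a] with [d], so
    [exchange_prev] applies there. *)
Lemma exchange_next_commute b c d z s :
    b \is a GRing.unit -> z \is a GRing.unit ->
    b * c = c * z * b -> d * z * b = 1 + c ^+ s ->
  c * d = d * z * c.
Proof.
move=> Ub Uz bc dzb.
rewrite -mulrA; apply: (@exchange_prev R^c d c b z s) => //.
  by rewrite -[LHS]/(b * c) bc -mulrA.
by rewrite revrX -dzb -mulrA.
Qed.

(** The same symmetry, which also exchanges [r] and [s], applied to [exchange_next]. *)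
Lemma exchange_previous a b c d z r s :
    b \is a GRing.unit -> d \is a GRing.unit -> z \is a GRing.unit ->
    b * c = c * z * b -> c * z * a = 1 + b ^+ r.+1 -> d * z * b = 1 + c ^+ s ->
  b * (d * z * a ^+ s - \sum_(j < s) c ^+ j * b ^+ r * a ^+ j) = 1 + a ^+ s.
Proof.
move=> Ub Ud Uz bc cza dzb.
have := @exchange_next R^c d c b a z s r Ud Ub Uz; rewrite !revrX => <- //.
- congr (b * (_ - _)); first by rewrite -mulrA.
  by apply: eq_bigr => j _; rewrite !revrX -mulrA.
- by rewrite -[LHS]/(b * c) bc -mulrA.
- by rewrite -dzb -mulrA.
by rewrite -cza -mulrA.
Qed.
End Converse.

(** * Closure properties of a generated subalgebra *)

Section GenSubalg.
Variables (R : pzRingType) (A : lalgType R) (S : A -> Prop).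
Local Notation G := (gen_subalg S).

Lemma gen_subalg0 : G 0.
Proof.
have := gen_subalg_lin (-1) (gen_subalg_1 S) (gen_subalg_1 S).
by rewrite scaleN1r addNr.
Qed.

Lemma gen_subalgD u v : G u -> G v -> G (u + v).
Proof. by move=> Gu Gv; rewrite -[u]scale1r; apply: gen_subalg_lin. Qed.

Lemma gen_subalgB u v : G u -> G v -> G (u - v).
Proof. by move=> Gu Gv; rewrite addrC -scaleN1r; apply: gen_subalg_lin. Qed.

Lemma gen_subalgX u n : G u -> G (u ^+ n).
Proof.
move=> Gu; elim: n => [|n IHn]; first exact: gen_subalg_1.
by rewrite exprS; apply: gen_subalg_mul.
Qed.

Lemma gen_subalg_sum (I : finType) (F : I -> A) :
  (forall i, G (F i)) -> G (\sum_i F i).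
Proof.
by move=> GF; elim/big_ind: _ => //; [exact: gen_subalg0 | exact: gen_subalgD].
Qed.
End GenSubalg.

(** * The augmentation of a group algebra is a ring morphism *)

Section Augmentation.
Variables (R : comNzRingType) (G : groupType).

Definition aug (u : group_algebra R G) : R := mmap idfun (fun=> 1) u.

Fact aug_is_zmod_morphism : zmod_morphism aug.
Proof. exact: (raddfB (mmap idfun (fun=> 1 : R))). Qed.

HB.instance Definition _ :=
  GRing.isZmodMorphism.Build (group_algebra R G) R aug aug_is_zmod_morphism.

Lemma augU c (k : G) : aug (mkmalgU k c : {malg R[G]}) = c.
Proof. by rewrite /aug mmapU /= mulr1. Qed.

Lemma aug_elt (k : G) : aug (ga_elt k) = 1.
Proof. by rewrite unlock augU. Qed.

Fact aug_is_monoid_morphism : monoid_morphism aug.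
Proof.
split=> [|u v]; first by rewrite -(@ga_elt1 R G) aug_elt.
rewrite -[u * v]/(ga_mul u v : group_algebra R G) raddf_sum [aug u]mmapE mulr_suml.
apply: eq_bigr => k1 _; rewrite raddf_sum [aug v]mmapE mulr_sumr.
by apply: eq_bigr => k2 _; rewrite !mulr1; exact: augU.
Qed.

HB.instance Definition _ :=
  GRing.isMonoidMorphism.Build (group_algebra R G) R aug aug_is_monoid_morphism.
End Augmentation.

(** * Two-sided recursion and induction over the integers *)

Lemma int_chain (T : Type) (P : int -> T -> Prop) (E : int -> T -> T -> Prop)
    (f g : int -> T -> T) (x0 : T) :
    P 0 x0 ->
    (forall k x, P k x -> P (k + 1) (f k x) /\ E k x (f k x)) ->
    (forall k x, P k x -> P (k - 1) (g k x) /\ E (k - 1) (g k x) x) ->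
  exists h : int -> T, h 0 = x0 /\ forall k, P k (h k) /\ E k (h k) (h (k + 1)).
Proof.
move=> P0 fP gP.
pose hp := fix hp (n : nat) := if n is m.+1 then f m%:Z (hp m) else x0.
pose hn := fix hn (n : nat) := if n is m.+1 then g (- m%:Z) (hn m) else x0.
(* [hn n] sits at position [- n], and [Negz n] is [- n.+1]. *)
pose h k := match k with Posz n => hp n | Negz n => hn n.+1 end.
have Php n : P n%:Z (hp n).
  by elim: n => //= n /fP[+ _]; rewrite -PoszD addn1.
have Phn n : P (- n%:Z) (hn n).
  by elim: n => //= n /gP[+ _]; rewrite intS opprD [X in P X]addrC.
exists h; split=> // -[n|n].
  split; first exact: Php.
  by rewrite -PoszD addn1; case: (fP _ _ (Php n)).
split; first by rewrite NegzE; exact: Phn.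
have Negz_pred : - n%:Z - 1 = Negz n by rewrite NegzE intS opprD addrC.
have [_] := gP _ _ (Phn n); rewrite Negz_pred -[in h (Negz n + 1)]Negz_pred subrK.
(* Position [- n] is read from [hp] if [n = 0] and from [hn] otherwise; both start at [x0]. *)
by case: n {Negz_pred}.
Qed.

Lemma int_ind_from (P : int -> Prop) (k0 : int) :
    P k0 -> (forall k, P k -> P (k + 1)) -> (forall k, P k -> P (k - 1)) ->
  forall k, P k.
Proof.
move=> P0 Pp Pm k; rewrite -(subrK k0 k); elim: (k - k0) => [|n IHn|n IHn].
- by rewrite add0r.
- by rewrite intS addrC addrA addrAC; apply: Pp; rewrite addrC.
by rewrite intS opprD addrC addrA addrAC; apply: Pm; rewrite addrC.
Qed.

Lemma r_parityS r s k : r_parity r s (k + 1) = r_parity s r k.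
Proof.
case: k => n; first by rewrite /r_parity -PoszD addn1 /=; case: (odd n).
have -> : Negz n + 1 = - n%:Z by rewrite NegzE intS opprD addrAC addNr add0r.
rewrite /r_parity abszN /=.
by case: (odd n).
Qed.

Lemma r_parity_pred r s k : r_parity r s (k - 1) = r_parity s r k.
Proof. by rewrite -[in RHS](subrK 1 k) r_parityS. Qed.

Lemma in_FracP (D : unitRingType) (iota : F2 -> D) u : in_Frac iota (iota u).
Proof. by apply: gen_divring_gen; exists u. Qed.

Lemma lyC : ly1 * ly2 = ly2 * lz * ly1.
Proof. by rewrite -!ga_eltM /gz !mulgA mulgV mul1g mulgVK. Qed.

Lemma ly0P r1 : ly2 * lz * ly0 r1 = 1 + ly1 ^+ r1.
Proof.
by rewrite mulrA -!ga_eltM -mulgA (mulgA gz) mulgV mul1g mulgV ga_elt1 mul1r.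
Qed.

Lemma ly3P r2 : ly3 r2 * lz * ly1 = 1 + ly2 ^+ r2.
Proof. by rewrite -!mulrA -!ga_eltM mulgA mulgVK mulVg ga_elt1 mulr1. Qed.

(** * Seeds in the division ring *)

Section Cluster.
Variables (r1 r2 : nat) (D : unitRingType) (divD : division_ring D).
Variables (iota : {rmorphism F2 -> D}) (iota_inj : injective iota).
Hypotheses (r1_gt0 : (0 < r1)%N) (r2_gt0 : (0 < r2)%N).
Local Notation z := (iota lz).

Lemma unit_iota_elt g : iota (ga_elt g) \is a GRing.unit.
Proof.
apply/unitrP; exists (iota (ga_elt g^-1)).
by rewrite -!rmorphM -!ga_eltM mulVg mulgV ga_elt1 rmorph1.
Qed.

Lemma iota_lzV : z^-1 = iota (ga_elt gz^-1).
Proof.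
apply: (mulrI (unit_iota_elt gz)); rewrite divrr ?unit_iota_elt //.
by rewrite -rmorphM -ga_eltM mulgV ga_elt1 rmorph1.
Qed.

(* Positivity of the augmentation keeps all cluster variables invertible in D. *)
Definition positive_calA (x : D) : Prop :=
  exists u : F2, [/\ in_calA r1 r2 u, 0 < aug u & x = iota u].

Lemma positive_calA_unit x : positive_calA x -> x \is a GRing.unit.
Proof.
move=> [u [_ u_gt0 ->]]; apply: divD; rewrite -(rmorph0 iota) (inj_eq iota_inj).
by apply: contraTneq u_gt0 => ->; rewrite raddf0 ltxx.
Qed.

(** The pair stands for [(y_k, y_(k+1))], with [a] and [d] for [y_(k-1)] and [y_(k+2)]. All four
    must lie in the algebra for the invariant to propagate: the formula for the next variable
    involves each of them. *)
Definition seed (r s : nat) (x : D * D) : Prop :=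
  [/\ x.1 * x.2 = x.2 * z * x.1, positive_calA x.1, positive_calA x.2 &
   exists a d, [/\ positive_calA a, positive_calA d,
     x.2 * z * a = 1 + x.1 ^+ r & d * z * x.1 = 1 + x.2 ^+ s]].

Definition seed_next (s : nat) (x : D * D) : D * D :=
  (x.2, (1 + x.2 ^+ s) * x.1^-1 * z^-1).

Definition seed_prev (r : nat) (x : D * D) : D * D :=
  (z^-1 * x.2^-1 * (1 + x.1 ^+ r), x.1).

Lemma in_calA_lz : in_calA r1 r2 lz.
Proof. by apply: gen_subalg_gen; right; left. Qed.

Lemma in_calA_lzV : in_calA r1 r2 (ga_elt gz^-1).
Proof. by apply: gen_subalg_gen; right; right. Qed.

Lemma positive_calA_mul x y :
  positive_calA x -> positive_calA y -> positive_calA (x * y).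
Proof.
move=> [u [Cu u_gt0 ->]] [v [Cv v_gt0 ->]]; exists (u * v).
by rewrite !rmorphM mulr_gt0 //; split=> //; apply: gen_subalg_mul.
Qed.

Lemma positive_calA_zV : positive_calA z^-1.
Proof.
exists (ga_elt gz^-1); split; [exact: in_calA_lzV | | exact: iota_lzV].
by rewrite aug_elt ltr01.
Qed.

(** Membership is visible from the formula for [x], but positivity is not, because of the minus
    sign. It comes from the product with [w]: its augmentation is [1 + (aug t') ^+ k], and [aug w']
    is positive. The free exponents cover both [exchange_next] and its mirror image. *)
Lemma positive_calA_exchange a b c d e w t m n p q k
    (x := d ^+ m * z * a ^+ n - \sum_(j < p) e ^+ j * c ^+ q * b ^+ j) :
    positive_calA a -> positive_calA b -> positive_calA c -> positive_calA d ->
    positive_calA e -> positive_calA w -> positive_calA t ->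
    x * w = 1 + t ^+ k \/ w * x = 1 + t ^+ k ->
  positive_calA x.
Proof.
rewrite {}/x; move=> [a' [Ca _ ->]] [b' [Cb _ ->]] [c' [Cc _ ->]] [d' [Cd _ ->]].
move=> [e' [Ce _ ->]] [w' [_ w_gt0 ->]] [t' [_ t_gt0 ->]].
set u := d' ^+ m * lz * a' ^+ n - \sum_(j < p) e' ^+ j * c' ^+ q * b' ^+ j.
have -> : iota d' ^+ m * z * iota a' ^+ n
    - \sum_(j < p) iota e' ^+ j * iota c' ^+ q * iota b' ^+ j = iota u.
  rewrite rmorphB !rmorphM !rmorphXn rmorph_sum; congr (_ - _).
  by apply: eq_bigr => j _; rewrite !rmorphM !rmorphXn.
rewrite -!rmorphM -rmorphXn -(rmorph1 iota) -rmorphD => uw.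
exists u; split=> //.
  apply: gen_subalgB.
    apply: gen_subalg_mul; last exact: gen_subalgX.
    by apply: gen_subalg_mul; [exact: gen_subalgX | exact: in_calA_lz].
  apply: gen_subalg_sum => j; apply: gen_subalg_mul; last exact: gen_subalgX.
  by apply: gen_subalg_mul; exact: gen_subalgX.
have aug_uw : aug u * aug w' = aug (1 + t' ^+ k).
  by case: uw => /iota_inj <-; rewrite rmorphM // mulrC.
rewrite -(pmulr_lgt0 _ w_gt0) aug_uw rmorphD rmorph1 rmorphXn.
by rewrite ltr_wpDr ?ltr01 // exprn_ge0 // ltW.
Qed.

Lemma seed_nextP r s x : (0 < s)%N -> seed r s x ->
  seed s r (seed_next s x) /\ (seed_next s x).2 * z * x.1 = 1 + x.2 ^+ s.
Proof.
case: s x => // s [b c] _ [/= bc Pb Pc [a [d [Pa Pd cza dzb]]]].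
have Uz : z \is a GRing.unit := unit_iota_elt gz.
have [Ua Ub Uc] := And3 (positive_calA_unit Pa) (positive_calA_unit Pb)
  (positive_calA_unit Pc).
(* The quotient defining the new variable is the witness [d], already known to lie in the
   algebra. *)
rewrite /seed_next /= -dzb !mulrK //; split=> //.
split=> //=; first exact: exchange_next_commute bc dzb.
have := exchange_next Ua Uc Uz bc cza dzb; rewrite -{1}[a]expr1.
(* [x] plays the role of [y_(k+3) * z], hence the factor [z^-1]. *)
set x := (_ - _) => xc; exists b, (x * z^-1).
split; rewrite ?divrK //; apply: positive_calA_mul positive_calA_zV.
exact: (positive_calA_exchange Pa Pb Pc Pd Pd Pc Pd (or_introl xc)).
Qed.

Lemma seed_prevP r s x : (0 < r)%N -> seed r s x ->
  seed s r (seed_prev r x) /\ x.2 * z * (seed_prev r x).1 = 1 + x.1 ^+ r.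
Proof.
case: r x => // r [b c] _ [/= bc Pb Pc [a [d [Pa Pd cza dzb]]]].
have Uz : z \is a GRing.unit := unit_iota_elt gz.
have [Ub Uc Ud] := And3 (positive_calA_unit Pb) (positive_calA_unit Pc)
  (positive_calA_unit Pd).
(* Here the new variable is the witness [a]. *)
rewrite /seed_prev /= -cza -!mulrA !mulKr // !mulrA.
split=> //; split=> //=; first exact: exchange_prev bc cza.
have := exchange_previous Ub Ud Uz bc cza dzb; rewrite -{1}[d]expr1.
set x := (_ - _) => bx; exists (z^-1 * x), c.
split; rewrite // -?[b * z * _]mulrA ?mulVKr //.
apply: positive_calA_mul positive_calA_zV _.
exact: (positive_calA_exchange Pa Pa Pb Pd Pc Pb Pa (or_intror bx)).
Qed.

Lemma seed_initial : seed r1 r2 (iota ly1, iota ly2).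
Proof.
have pos_elt g : in_calA r1 r2 (ga_elt g) -> positive_calA (iota (ga_elt g)).
  by move=> Cg; exists (ga_elt g); rewrite aug_elt ltr01.
have pos_aug (t : F2) n : aug t = 1 -> 0 < aug (1 + t ^+ n).
  by move=> t1; rewrite rmorphD rmorph1 rmorphXn /= t1 expr1n addr_gt0 ?ltr01.
split=> /=; first by rewrite -!rmorphM lyC.
- by apply: pos_elt; apply: gen_subalg_gen; left; apply: Or42.
- by apply: pos_elt; apply: gen_subalg_gen; left; apply: Or43.
exists (iota (ly0 r1)), (iota (ly3 r2)); split.
- exists (ly0 r1); split=> //; first by apply: gen_subalg_gen; left; apply: Or41.
  by rewrite /ly0 rmorphM /= aug_elt mul1r pos_aug // aug_elt.
- exists (ly3 r2); split=> //; first by apply: gen_subalg_gen; left; apply: Or44.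
  by rewrite /ly3 rmorphM /= aug_elt mulr1 pos_aug // aug_elt.
- by rewrite -!rmorphM ly0P rmorphD rmorph1 rmorphXn.
by rewrite -!rmorphM ly3P rmorphD rmorph1 rmorphXn.
Qed.

Lemma cluster_seeds : exists x : int -> D * D,
  [/\ x 1 = (iota ly1, iota ly2),
      forall k, seed (r_parity r1 r2 k) (r_parity r2 r1 k) (x k)
    & forall k : int, (x (k + 1)).1 = (x k).2 /\
        (x (k + 1)).2 * z * (x k).1 = 1 + (x k).2 ^+ r_parity r2 r1 k].
Proof.
(* [int_chain] starts at 0 but the initial seed has index 1: the parities are swapped here, and the
   index is shifted back when the sequence is exhibited. *)
pose P (k : int) := seed (r_parity r2 r1 k) (r_parity r1 r2 k).
have r_gt0 k : ((0 < r_parity r1 r2 k)%N * (0 < r_parity r2 r1 k)%N)%type.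
  by rewrite /r_parity; case: ifP.
pose E (k : int) (x y : D * D) := y.1 = x.2 /\
  y.2 * z * x.1 = 1 + x.2 ^+ r_parity r1 r2 k.
have [k x Px|k x Px|x [x0 xP]] := @int_chain _ P E
    (fun k => seed_next (r_parity r1 r2 k)) (fun k => seed_prev (r_parity r2 r1 k))
    (iota ly1, iota ly2) seed_initial.
- rewrite /P !r_parityS; have [] := seed_nextP _ Px; first by rewrite r_gt0.
  by split.
- rewrite /P /E !r_parity_pred; have [] := seed_prevP _ Px; first by rewrite r_gt0.
  by split.
exists (fun k => x (k - 1)); split=> [|k|k]; first by rewrite subrr.
  by have [] := xP (k - 1); rewrite /P !r_parity_pred.
have [_] := xP (k - 1); rewrite /E r_parity_pred.
by rewrite subrK addrK.
Qed.
End Cluster.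

Theorem theorem4 (r1 r2 : nat) (r1_gt0 : (0 < r1)%N) (r2_gt0 : (0 < r2)%N)
    (D : unitRingType) (divD : division_ring D)
    (iota : {rmorphism F2 -> D}) (iota_inj : injective iota) :
  exists y : int -> D,
    [/\ cluster_seq r1 r2 iota y,
        forall y' : int -> D, cluster_seq r1 r2 iota y' -> y' =1 y
      & forall k : int, exists u : F2, in_calA r1 r2 u /\ y k = iota u].
Proof.
have [x [x1 xP xE]] := cluster_seeds divD iota_inj r1_gt0 r2_gt0.
have Uz : iota lz \is a GRing.unit := unit_iota_elt iota gz.
have x2 k : (x k).2 = (x (k + 1)).1 by case: (xE k).
have exchange k : (x (k + 1)).1 * iota lz * (x (k - 1)).1
    = 1 + (x k).1 ^+ r_parity r1 r2 k.
  by have [+] := xE (k - 1); rewrite subrK -x2 r_parity_pred => <-.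
have Ux k : (x k).1 \is a GRing.unit.
  by have [_ /(positive_calA_unit divD iota_inj)] := xP k.
exists (fun k => (x k).1); split=> [|y' [_ y'1 y'2 y'E] k|k].
- split=> // [k||]; last by rewrite -[2]/(1 + 1 : int) -x2 x1.
    by have [_ [u [_ _ ->]] _ _] := xP k; apply: in_FracP.
  by rewrite x1.
(* Uniqueness: two consecutive terms determine the rest, because [iota lz] and all the [(x k).1] are
   units, so the exchange relation can be solved in both directions. *)
- suff [] : y' k = (x k).1 /\ y' (k + 1) = (x (k + 1)).1 by [].
  move: k; apply: (@int_ind_from _ 1) => [|k [yk yk1]|k [yk yk1]].
  + by rewrite y'1 -[1 + 1]/(2 : int) y'2 -[2]/(1 + 1 : int) -x2 x1.
  + split=> //; apply: (mulIr Uz); apply: (mulIr (Ux k)).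
    have := y'E (k + 1); have := exchange (k + 1).
    by rewrite addrK yk yk1 => -> ->.
  split; last by rewrite subrK.
  have Uxz : (x (k + 1)).1 * iota lz \is a GRing.unit by rewrite unitrMr.
  by apply: (mulrI Uxz); rewrite exchange -yk1 y'E yk.
by have [_ [u [Cu _ ->]] _ _] := xP k; exists u.
Qed.
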